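(* Let $\mu\in\mathbb H$ and $\theta\in\mathbb R\setminus\mathbb Q$. Then the homomorphism ${\rm std}_{(\mu,\theta)}:{}^{\bullet}\tilde L_{(\mu,\theta)}\to\mathbb T_\mu$ is surjective and its kernel is ${}^{\ast}\Lambda_{(\mu,\theta)}$.
   Context: Fix a nonprincipal ultrafilter $\mathcal V$ on $\mathbb N$; ${}^{\ast}\mathbb Z\subset{}^{\ast}\mathbb R\subset{}^{\ast}\mathbb C$ are the ultrapowers; ${}^{\ast}\mathbb R_\epsilon,{}^{\ast}\mathbb C_\epsilon$ are the infinitesimals (absolute value below every positive real), ${}^{\bullet}\mathbb R={}^{\ast}\mathbb R/{}^{\ast}\mathbb R_\epsilon$, ${}^{\bullet}\mathbb C={}^{\ast}\mathbb C/{}^{\ast}\mathbb C_\epsilon$. $\Lambda_\mu=\mathbb Z+\mathbb Z\mu$, $\mathbb T_\mu=\mathbb C/\Lambda_\mu$, ${}^{\ast}\Lambda_\mu$ the ultrapower of $\Lambda_\mu$ embedded in ${}^{\bullet}\mathbb C$, and ${}^{\bullet}\tilde L_{(\mu,\theta)}={}^{\bullet}\mathbb R\cdot(\theta\mu+1)\subset{}^{\bullet}\mathbb C$. ${}^{\ast}\mathbb Z_\theta=\{{}^{\ast}n\in{}^{\ast}\mathbb Z:\exists\,{}^{\ast}m\in{}^{\ast}\mathbb Z,\ {}^{\ast}n\theta-{}^{\ast}m\in{}^{\ast}\mathbb R_\epsilon\}$; the (unique) such ${}^{\ast}m$ is denoted ${}^{\ast}n^\perp$, and ${}^{\ast}\Lambda_{(\mu,\theta)}=\{\mu\,{}^{\ast}n^\perp+{}^{\ast}n:{}^{\ast}n\in{}^{\ast}\mathbb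 Z_\theta\}\subset{}^{\ast}\Lambda_\mu$. For ${}^{\bullet}r\in{}^{\bullet}\mathbb R$ with representative sequence $(r_\alpha)$, ${\rm std}_{(\mu,\theta)}({}^{\bullet}r(\theta\mu+1))$ is the limit along $\mathcal V$, in the compact space $\mathbb T_\mu$, of the images of $r_\alpha(\theta\mu+1)$ (independent of the representative). *)

(* Defs.v *)
(* MathComp-Analysis; the complex numbers are [R[i]] over [R : realType]. *)
From HB Require Import structures.
From mathcomp Require Import all_boot all_order all_algebra ring_quotient.
From mathcomp Require Import complex.
From mathcomp Require Import all_classical all_reals all_analysis.

Set Implicit Arguments.
Unset Strict Implicit.
Unset Printing Implicit Defensive.

Import Order.TTheory GRing.Theory Num.Theory.
Import numFieldNormedType.Exports.

Local Open Scope classical_set_scope.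
Local Open Scope ring_scope.
Local Open Scope complex_scope.
Local Open Scope quotient_scope.

Record nonprincipal_ultrafilter := NonprincipalUltrafilter {
  uf_sets :> set_system nat;
  uf_ultra : UltraFilter uf_sets;
  uf_nonprincipal : forall n, uf_sets <> principal_filter n }.

#[global] Existing Instance uf_ultra.

Section Ultrapower.
Variables (V : nonprincipal_ultrafilter) (K : comNzRingType).

Definition null_seq (f : nat -> K) : bool :=
  `[< \forall n \near uf_sets V, f n = 0 >].

Lemma null_seqP (f : nat -> K) :
  reflect (\forall n \near uf_sets V, f n = 0) (f \in null_seq).
Proof. exact: asboolP. Qed.

Lemma null_seq_idealr : idealr_closed null_seq.
Proof.
split.
- by apply/null_seqP; exact: filterE.
- apply/negP => /null_seqP V0.
  have /filter_ex[n /eqP] := V0.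
  by rewrite (_ : (1 : nat -> K) n = 1) // oner_eq0.
- move=> a u v /null_seqP u0 /null_seqP v0; apply/null_seqP.
  apply: filterS2 u0 v0 => n u0 v0.
  by rewrite (_ : (a * u + v) n = a n * u n + v n) // u0 v0 mulr0 addr0.
Qed.

HB.instance Definition _ := isIdealr.Build (nat -> K) null_seq null_seq_idealr.

Definition null_ideal : idealr (nat -> K) := null_seq.

End Ultrapower.

(* Ultrapower K^nat / V, as a quotient of the ring of sequences. *)
Notation star V K := {ideal_quot (null_ideal V K)}.

Section Embeddings.
Variable V : nonprincipal_ultrafilter.

Definition starcl (K : comNzRingType) (f : nat -> K) : star V K := \pi f.

Definition star_cst (K : comNzRingType) (c : K) : star V K := starcl (cst c).

Definition star_map (K L : comNzRingType) (h : {rmorphism K -> L})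
  (x : star V K) : star V L := starcl (h \o repr x).

Lemma starcl_eq (K : comNzRingType) (f g : nat -> K) :
  starcl f = starcl g <-> \forall n \near uf_sets V, f n = g n.
Proof.
rewrite /starcl; split => [/eqP|fg].
- rewrite -Quotient.idealrBE => /null_seqP; apply: filterS => n.
  by rewrite -[(f - g) n]/(f n - g n) => /eqP; rewrite subr_eq0 => /eqP.
- apply/eqP; rewrite -Quotient.idealrBE; apply/null_seqP.
  move: fg; apply: filterS => n fgn.
  by rewrite -[(f - g) n]/(f n - g n) fgn subrr.
Qed.

Lemma starcl_repr (K : comNzRingType) (x : star V K) : starcl (repr x) = x.
Proof. exact: reprK. Qed.

Lemma starclD (K : comNzRingType) (f g : nat -> K) :
  starcl (fun n => f n + g n) = starcl f + starcl g.
Proof. exact: rmorphD. Qed.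

Lemma starclB (K : comNzRingType) (f g : nat -> K) :
  starcl (fun n => f n - g n) = starcl f - starcl g.
Proof. exact: rmorphB. Qed.

Lemma starclM (K : comNzRingType) (f g : nat -> K) :
  starcl (fun n => f n * g n) = starcl f * starcl g.
Proof. exact: rmorphM. Qed.

Lemma repr_starcl (K : comNzRingType) (f : nat -> K) :
  \forall n \near uf_sets V, repr (starcl f) n = f n.
Proof. by apply/starcl_eq; rewrite /starcl reprK. Qed.

Lemma star_map_starcl (K L : comNzRingType) (h : {rmorphism K -> L})
  (f : nat -> K) : star_map h (starcl f) = starcl (h \o f).
Proof.
apply/starcl_eq; have := repr_starcl f; apply: filterS => n fn.
by rewrite /= fn.
Qed.

End Embeddings.

Section Infinitesimals.
Variables (V : nonprincipal_ultrafilter) (K : numFieldType).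

(* By Los, |x| < e in [star V K] holds iff it holds on a set of [V]
   (any representative will do, see [infinitesimal_starcl]).
   In [R[i]], [0 < e] means that [e] is a positive real. *)
Definition infinitesimal : {pred star V K} := fun x =>
  `[< forall e : K, 0 < e -> \forall n \near uf_sets V, `|repr x n| < e >].

Lemma infinitesimalP (x : star V K) :
  reflect (forall e : K, 0 < e -> \forall n \near uf_sets V, `|repr x n| < e)
          (x \in infinitesimal).
Proof. exact: asboolP. Qed.

Lemma infinitesimal_starcl (f : nat -> K) :
  starcl V f \in infinitesimal <->
  forall e : K, 0 < e -> \forall n \near uf_sets V, `|f n| < e.
Proof.
split => [/infinitesimalP|] fe; last apply/infinitesimalP;
  move=> e /fe; apply: filterS2 (repr_starcl V f) => n ->; exact.
Qed.

Lemma infinitesimal_zmod : zmod_closed infinitesimal.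
Proof.
split.
- rewrite -[0]/(0 : star V K) -[0]reprK; apply/infinitesimal_starcl => e e0.
  have : \forall n \near uf_sets V, repr (0 : star V K) n = 0.
    by apply: (iffLR (starcl_eq V _ (0 : nat -> K))); rewrite /starcl reprK piE.
  by apply: filterS => n ->; rewrite normr0.
- move=> x y /infinitesimalP xe /infinitesimalP ye.
  rewrite -[x]reprK -[y]reprK -rmorphB; apply/infinitesimal_starcl => e e0.
  have e2 : 0 < e / 2 by rewrite divr_gt0.
  apply: filterS2 (xe _ e2) (ye _ e2) => n xn yn.
  by rewrite (le_lt_trans (ler_normB _ _)) // [ltRHS]splitr ltrD.
Qed.

HB.instance Definition _ :=
  GRing.isZmodClosed.Build (star V K) infinitesimal infinitesimal_zmod.

End Infinitesimals.

Arguments infinitesimal V K : clear implicits.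

Notation bullet V K := (Quotient.quot (infinitesimal V K)).

Definition bulletcl (V : nonprincipal_ultrafilter) (K : numFieldType)
  (x : star V K) : bullet V K := \pi x.

Lemma bulletcl_eq (V : nonprincipal_ultrafilter) (K : numFieldType)
  (x y : star V K) : bulletcl x = bulletcl y <-> x - y \in infinitesimal V K.
Proof.
by rewrite Quotient.idealrBE; split => [/eqP|/eqP].
Qed.

Section Torus.
Variables (R : realType) (mu : R[i]).

Definition lattice : {pred R[i]} := fun z =>
  `[< exists a b : int, z = a%:~R + b%:~R * mu >].

Lemma lattice_zmod : zmod_closed lattice.
Proof.
split; first by apply/asboolP; exists 0, 0; rewrite mul0r addr0.
move=> x y /asboolP[a [b ->]] /asboolP[c [d ->]]; apply/asboolP.
by exists (a - c), (b - d); rewrite !intrB mulrBl opprD addrACA.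
Qed.

HB.instance Definition _ := GRing.isZmodClosed.Build R[i] lattice lattice_zmod.

Definition torus : Type := Quotient.quot lattice.

HB.instance Definition _ := GRing.Zmodule.on torus.
HB.instance Definition _ := isPointed.Build torus 0.

Definition torus_proj (z : R[i]) : torus := \pi_(Quotient.quot lattice) z.

(* [R[i]^o] carries the topology of the modulus, [torus] the quotient one. *)
Definition torus_open (U : set torus) := open (torus_proj @^-1` U : set R[i]^o).

Lemma torus_openT : torus_open setT.
Proof. by rewrite /torus_open preimage_setT; exact: openT. Qed.

Lemma torus_openI (A B : set torus) :
  torus_open A -> torus_open B -> torus_open (A `&` B).
Proof. exact: openI. Qed.

Lemma torus_open_bigcup (I : Type) (f : I -> set torus) :
  (forall i, torus_open (f i)) -> torus_open (\bigcup_i f i).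
Proof.
move=> fo; rewrite /torus_open preimage_bigcup; apply: bigcup_open => i _.
exact: fo.
Qed.

HB.instance Definition _ :=
  isOpenTopological.Build torus torus_openT torus_openI torus_open_bigcup.

End Torus.

Lemma small_int (a : int) : `|a| < 1 -> a = 0.
Proof. by case: a => [[|n]|n]. Qed.

Section Std.
Variables (R : realType) (V : nonprincipal_ultrafilter).
Variables (mu : R[i]) (theta : R).

Definition slope : R[i] := theta%:C * mu + 1.

(* [r * z] for [z] a standard complex number; independent of the
   representative by [bullet_scaleE]. *)
Definition bullet_scale (r : bullet V R) (z : R[i]) : bullet V R[i] :=
  bulletcl (star_map (real_complex R) (repr r) * star_cst V z).

Lemma bullet_scaleE (r : nat -> R) (z : R[i]) :
  bullet_scale (bulletcl (starcl V r)) z =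
  bulletcl (starcl V (fun n => (r n)%:C * z)).
Proof.
apply/bulletcl_eq; rewrite /star_map /star_cst -starclM -starclB.
have /bulletcl_eq : bulletcl (repr (bulletcl (starcl V r))) =
    bulletcl (starcl V r) by exact: reprK.
rewrite -[X in X - _]starcl_repr -starclB => /infinitesimal_starcl r0.
apply/infinitesimal_starcl => e e0.
have [->|z0] := eqVneq z 0.
  by apply: filterE => n; rewrite !mulr0 subrr normr0.
have : 0 < e / `|z| by rewrite divr_gt0 ?normr_gt0.
case dE : (e / `|z|) => [d d'].
rewrite ltcE /= => /andP[/eqP d'0 d0]; have := r0 d d0; apply: filterS => n rd.
rewrite -mulrBl normrM -ltr_pdivlMr ?normr_gt0// dE d'0 -rmorphB normc_def /=.
by rewrite expr0n /= addr0 sqrtr_sqr ltcR.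
Qed.

Definition bullet_line : set (bullet V R[i]) :=
  [set bullet_scale r slope | r in [set: bullet V R]].

(* Only meaningful on [bullet_line]. A representative sequence of the point is
   picked, and [lim] is a choice operator: convergence, and independence of the
   representative, have to be proved. *)
Definition std (x : bullet V R[i]) : torus mu :=
  let r := xget 0 [set r : bullet V R | bullet_scale r slope = x] in
  lim ((fun n => torus_proj mu ((repr (repr r) n)%:C * slope)) @ uf_sets V).

Definition starZ_near (n m : star V int) : Prop :=
  star_map intr n * star_cst V theta - star_map intr m \in infinitesimal V R.

Definition starZ_theta : set (star V int) :=
  [set n | exists m, starZ_near n m].

Lemma starZ_near_unique (n m m' : star V int) :
  starZ_near n m -> starZ_near n m' -> m = m'.
Proof.
move=> nm nm'; have := rpredB nm' nm.
rewrite opprB addrC addrA subrK /star_map -starclB.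
move=> /infinitesimal_starcl /(_ 1 ltr01) mm'.
rewrite -[m]starcl_repr -[m']starcl_repr; apply/starcl_eq.
move: mm'; apply: filterS => k.
rewrite /= -intrB -intr_norm -[1]/(1%:~R) ltr_int.
by move/small_int/eqP; rewrite subr_eq0 => /eqP.
Qed.

(* Well defined on [starZ_theta] by [starZ_near_unique]. *)
Definition perp (n : star V int) : star V int := xget 0 [set m | starZ_near n m].

Definition star_lattice_theta : set (star V R[i]) :=
  [set star_cst V mu * star_map intr (perp n) + star_map intr n
     | n in starZ_theta].

(* The ultrapower of [lattice mu], inside that of [R[i]]; it embeds in
   [bullet V R[i]] by [bulletcl_star_lattice_inj]. *)
Definition star_lattice : set (star V R[i]) :=
  [set starcl V f | f in [set f | forall k, f k \in lattice mu]].

Lemma star_lattice_theta_sub : star_lattice_theta `<=` star_lattice.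
Proof.
move=> _ [n _ <-].
exists (fun k => mu * (repr (perp n) k)%:~R + (repr n k)%:~R); last first.
  by rewrite starclD starclM.
by move=> k /=; apply/asboolP; exists (repr n k), (repr (perp n) k);
  rewrite addrC mulrC.
Qed.

Lemma lattice_discrete : 0 < complex.Im mu ->
  exists2 e : R[i], 0 < e & forall z, z \in lattice mu -> `|z| < e -> z = 0.
Proof.
move=> mu0; set e := Num.min 1 (complex.Im mu).
have e0 : 0 < e by rewrite lt_min ltr01.
exists e%:C => [|_ /asboolP[a [b ->]]]; first by rewrite ltcR.
have intE (c : int) : c%:~R = (c%:~R : R)%:C :> R[i] by rewrite rmorph_int.
case: mu mu0 @e e0 => x y y0 e e0; rewrite !intE normc_def ltcR /= => zlt.
have small t u : Num.sqrt (t ^+ 2 + u ^+ 2) < e -> `|t| < e /\ `|u| < e.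
  by move=> tu; rewrite -!sqrtr_sqr; split; apply: le_lt_trans tu;
    rewrite ler_wsqrtr// ?lerDl ?lerDr sqr_ge0.
have [re im] := small _ _ zlt; move: im re.
rewrite mul0r addr0 add0r normrM (gtr0_norm y0) => im.
have b0 : b = 0.
  have : `|b%:~R| * y < 1 * y.
    by rewrite mul1r (lt_le_trans im)// /e ge_min lexx orbT.
  by rewrite ltr_pM2r// -intr_norm -[1]/(1%:~R) ltr_int => /small_int.
rewrite b0 !mul0r subr0 addr0 => re.
have -> : a = 0.
  have : `|a%:~R : R| < 1 by rewrite (lt_le_trans re)// /e ge_min lexx.
  by rewrite -intr_norm -[1]/(1%:~R) ltr_int => /small_int.
by rewrite !rmorph0 ?mul0r addr0.
Qed.

Lemma bulletcl_star_lattice_inj : 0 < complex.Im mu ->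
  {in star_lattice &, injective (@bulletcl V R[i])}.
Proof.
move=> /lattice_discrete[e e0 eP] _ _ /set_mem[f fL <-] /set_mem[g gL <-].
move=> /bulletcl_eq; rewrite -starclB => /infinitesimal_starcl /(_ e e0) fg.
apply/starcl_eq; move: fg; apply: filterS => n /eP fg.
by apply/eqP; rewrite -subr_eq0 fg// rpredB// ?fL ?gL.
Qed.

End Std.

Arguments bullet_line {R} V mu theta.
Arguments std {R} V mu theta x.
Arguments star_lattice_theta {R} V mu theta.

(* Main.v *)
(* A sequence [f] converges along [V] in the torus to the class of [l] iff
   [f - l] is infinitesimally close to a sequence of lattice points; since the
   lattice is discrete, this makes limits unique, and since the coordinates of
   [f] modulo 1 lie in [[0, 1]], limits exist.  On the line,
   [r * slope - (a + b * mu) = (r - a) + (r * theta - b) * mu], so [r * slope]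
   has limit 0 iff [r] is infinitely close to some [a] in [*Z] and [r * theta]
   to some [b] in [*Z], i.e. [a * theta - b] is infinitesimal and [b] is the
   dual of [a].  Surjectivity is the density of [Z * theta + Z] in the reals,
   itself obtained by pigeonhole from an ultralimit of the fractional parts of
   [n * theta]. *)
Require Import Defs.
From mathcomp Require Import all_boot all_order all_algebra.
From mathcomp Require Import complex ring.
From mathcomp Require Import all_classical all_reals all_analysis.

Set Implicit Arguments.
Unset Strict Implicit.
Unset Printing Implicit Defensive.

Import Order.TTheory GRing.Theory Num.Theory.
Import numFieldNormedType.Exports.

Local Open Scope classical_set_scope.
Local Open Scope ring_scope.
Local Open Scope complex_scope.

(** * Stability of infinitesimals under domination, scaling and sums *)

Section Infinitesimal.
Variables (V : nonprincipal_ultrafilter) (K : numFieldType).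

Lemma infinitesimal_le (f g : nat -> K) : (forall n, `|f n| <= `|g n|) ->
  starcl V g \in infinitesimal V K -> starcl V f \in infinitesimal V K.
Proof.
move=> fg /infinitesimal_starcl g0; apply/infinitesimal_starcl => e /g0.
by apply: filterS => n; apply: le_lt_trans.
Qed.

Lemma infinitesimal_ext (f g : nat -> K) : f =1 g ->
  starcl V g \in infinitesimal V K -> starcl V f \in infinitesimal V K.
Proof. by move=> fg; apply: infinitesimal_le => n; rewrite fg. Qed.

Lemma infinitesimalMr (f : nat -> K) (c : K) :
  starcl V f \in infinitesimal V K ->
  starcl V (fun n => f n * c) \in infinitesimal V K.
Proof.
have [->|c0] := eqVneq c 0.
  move=> _; apply/infinitesimal_starcl => e e0.
  by apply: filterE => n; rewrite mulr0 normr0.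
move=> /infinitesimal_starcl f0; apply/infinitesimal_starcl => e e0.
have /f0 : 0 < e / `|c| by rewrite divr_gt0 ?normr_gt0.
by apply: filterS => n; rewrite normrM -ltr_pdivlMr ?normr_gt0.
Qed.

Lemma infinitesimalD (f g : nat -> K) :
  starcl V f \in infinitesimal V K -> starcl V g \in infinitesimal V K ->
  starcl V (fun n => f n + g n) \in infinitesimal V K.
Proof. by move=> f0 g0; rewrite starclD rpredD. Qed.

Lemma infinitesimalB (f g : nat -> K) :
  starcl V f \in infinitesimal V K -> starcl V g \in infinitesimal V K ->
  starcl V (fun n => f n - g n) \in infinitesimal V K.
Proof. by move=> f0 g0; rewrite starclB rpredB. Qed.

End Infinitesimal.

(** * Infinitesimal complex sequences in real coordinates *)

Section Complex.
Variables (R : realType) (V : nonprincipal_ultrafilter).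
Implicit Types (f : nat -> R[i]) (x y : nat -> R).

(** In [R[i]], [0 < e] forces [e] to be real, so real tolerances suffice. *)
Lemma infinitesimal_complex f :
  starcl V f \in infinitesimal V R[i] <->
  forall e : R, 0 < e -> \forall n \near uf_sets V, `|f n| < e%:C.
Proof.
split=> [/infinitesimal_starcl f0 e e0|f0]; first by apply: f0; rewrite ltcR.
apply/infinitesimal_starcl => -[e e'].
by rewrite ltcE /= => /andP[/eqP -> /f0].
Qed.

Lemma norm_real_complex (a : R) : `|a%:C| = `|a|%:C.
Proof. by rewrite normc_def /= expr0n addr0 sqrtr_sqr. Qed.

Lemma infinitesimal_real_complex x :
  starcl V (fun n => (x n)%:C) \in infinitesimal V R[i] <->
  starcl V x \in infinitesimal V R.
Proof.
split=> [/infinitesimal_complex x0|/infinitesimal_starcl x0].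
  apply/infinitesimal_starcl => e /x0.
  by apply: filterS => n; rewrite norm_real_complex ltcR.
apply/infinitesimal_complex => e /x0.
by apply: filterS => n; rewrite norm_real_complex ltcR.
Qed.

Lemma infinitesimal_Im f : starcl V f \in infinitesimal V R[i] ->
  starcl V (fun n => complex.Im (f n)) \in infinitesimal V R.
Proof.
move=> f0; apply/infinitesimal_real_complex; apply: infinitesimal_le f0 => n.
rewrite norm_real_complex; case: (f n) => a b /=.
by rewrite normc_def lecR /= -sqrtr_sqr ler_wsqrtr// lerDr sqr_ge0.
Qed.

(** Since [Im mu] is nonzero, dividing the imaginary part by it recovers [y]; subtracting [y * mu]
    then leaves [x]. *)
Lemma infinitesimal_coord (mu : R[i]) x y : 0 < complex.Im mu ->
  starcl V (fun n => (x n)%:C + (y n)%:C * mu) \in infinitesimal V R[i] <->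
  starcl V x \in infinitesimal V R /\ starcl V y \in infinitesimal V R.
Proof.
move=> mu0; split=> [xy0|[x0 y0]]; last first.
  by apply: infinitesimalD; [|apply: infinitesimalMr];
    apply/infinitesimal_real_complex.
have y0 : starcl V y \in infinitesimal V R.
  have := infinitesimalMr (complex.Im mu)^-1 (infinitesimal_Im xy0).
  apply: infinitesimal_le => n; case: mu mu0 {xy0} => a b /= b0.
  by rewrite mul0r addr0 add0r mulfK// gt_eqF.
split=> //; apply/infinitesimal_real_complex.
have := infinitesimalB xy0
  (infinitesimalMr mu (iffRL (infinitesimal_real_complex y) y0)).
by apply: infinitesimal_le => n; rewrite addrK.
Qed.

End Complex.

(** * Limits along the ultrafilter, and density of [Z * theta + Z] *)

Section UltrafilterLimits.
Variables (R : realType) (V : nonprincipal_ultrafilter).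

Lemma uf_tail m : \forall n \near uf_sets V, (m <= n)%N.
Proof.
have VC k : \forall n \near uf_sets V, n <> k.
  (* If [[set k]] were in [V], every set of [V] would contain [k], and maximality would make [V]
     principal. *)
  have [Vk|//] := in_ultra_setVsetC [set k] (uf_ultra V).
  case: (@uf_nonprincipal V k); apply/esym.
  apply: (@max_filter _ _ (uf_ultra V)) => [|A VA].
    exact: principal_filter_proper.
  by have [n [/= -> Ak]] := filter_ex (filterI Vk VA); apply/principal_filterP.
elim: m => [|m IH]; first exact: filterE.
apply: filterS2 IH (VC m) => n mn /eqP nm.
by rewrite ltn_neqAle eq_sym nm.
Qed.

(** Compactness gives a cluster point, and a cluster point of an ultrafilter is a limit: otherwise
    the complement of some neighbourhood would belong to it. *)
Lemma unit_seq_ulimit (x : nat -> R) : (forall n, 0 <= x n <= 1) ->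
  exists l, starcl V (fun n => x n - l) \in infinitesimal V R.
Proof.
move=> x01; have x01V : (x @ uf_sets V) `[0, 1]%classic.
  by apply: (@filterE _ (uf_sets V)) => n; rewrite /= in_itv /=; exact: x01.
have [l [_ lx]] := segment_compact (fmap_proper_filter x _) x01V.
exists l; apply/infinitesimal_starcl => e e0.
pose near_l := [set n | `|x n - l| < e].
have [//|Vfar] := in_ultra_setVsetC near_l (uf_ultra V).
have [_ [[n nfar <-] nl]] : (x @` ~` near_l) `&` ball l e !=set0.
  apply: lx (nbhsx_ballx l e e0).
  by apply: filterS Vfar => n nfar; exists n.
by case: nfar; rewrite /near_l /= distrC.
Qed.

Lemma irrational_dense (theta b e : R) : irrational theta -> 0 < e ->
  exists k m : int, `|k%:~R * theta - m%:~R - b| < e.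
Proof.
move=> irr e0; pose x n := n%:R * theta - (Num.floor (n%:R * theta))%:~R.
have [n|l /infinitesimal_starcl xl] := @unit_seq_ulimit x.
  have /andP[h1 h2] := floor_itv (n%:R * theta).
  by rewrite /x subr_ge0 h1 lerBlDl ltW//; move: h2; rewrite intrD.
have e2 : 0 < e / 2 by rewrite divr_gt0.
have [n nl] := filter_ex (xl _ e2).
(* Taking [k] strictly above [n] makes [k - n] nonzero, so [x k = x n] would express [theta] as a
   fraction with denominator [k - n]. *)
have [k [kl nk]] := filter_ex (filterI (xl _ e2) (uf_tail n.+1)).
have [g0 [p gE]] : x k - x n != 0 /\
    exists p : int, x k - x n = (k%:Z - n%:Z)%:~R * theta - p%:~R.
  have gE : x k - x n = (k%:Z - n%:Z)%:~R * theta -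
      (Num.floor (k%:R * theta) - Num.floor (n%:R * theta))%:~R.
    by rewrite /x !intrB -!pmulrn; ring.
  split; last by eexists; exact: gE.
  rewrite gE; apply/eqP => /eqP; rewrite subr_eq0 => /eqP E.
  apply: irr; exists ((Num.floor (k%:R * theta) -
    Num.floor (n%:R * theta))%:~R / (k%:Z - n%:Z)%:~R) => //.
  rewrite rmorphM fmorphV /= !ratr_int -E mulrAC mulfV ?mul1r// intr_eq0.
  by rewrite subr_eq0; apply/eqP => -[] kn; rewrite kn /= ltnn in nk.
have ge : `|x k - x n| < e.
  rewrite -(subrKA l) [ltRHS]splitr (le_lt_trans (ler_normD _ _))//.
  by rewrite ltrD// distrC.
(* [g] is a nonzero element of [Z * theta + Z] smaller than [e]; its multiple by the integer part of
   [b / g] is within [|g|] of [b], whatever the sign of [g]. *)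
set g := x k - x n in g0 gE ge; set q := Num.floor (b / g).
exists (q * (k%:Z - n%:Z)), (q * p).
have -> : (q * (k%:Z - n%:Z))%:~R * theta - (q * p)%:~R - b =
    g * (q%:~R - b / g).
  have bE : g * (b / g) = b by rewrite mulrC divfK.
  by rewrite [RHS]mulrBr bE gE !intrM; ring.
rewrite normrM (le_lt_trans _ ge)// ler_piMr// distrC ger0_norm.
  have /andP[_] := floor_itv (b / g).
  by rewrite -/q intrD lerBlDl => /ltW.
by rewrite subr_ge0; have /andP[] := floor_itv (b / g).
Qed.

End UltrafilterLimits.

(** * Convergence along [V] in the torus *)

Section Torus.
Variables (R : realType) (V : nonprincipal_ultrafilter) (mu : R[i]).
Hypothesis mu0 : 0 < complex.Im mu.
Implicit Types (f : nat -> R[i]) (z l : R[i]).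

Lemma torus_proj_surj (t : torus mu) : exists z, torus_proj mu z = t.
Proof. by exists (repr (t : Quotient.quot (lattice mu))); exact: reprK. Qed.

Lemma torus_projP z l :
  torus_proj mu z = torus_proj mu l <-> z - l \in lattice mu.
Proof. by rewrite Quotient.idealrBE; split => [/eqP|/eqP]. Qed.

Lemma torus_projD z l :
  torus_proj mu (z + l) = torus_proj mu z + torus_proj mu l.
Proof. exact: raddfD. Qed.

Lemma open_torusE (U : set (torus mu)) :
  open U = open (torus_proj mu @^-1` U : set R[i]^o).
Proof. by []. Qed.

Lemma coordE z : exists a b : R, z = a%:C + b%:C * mu.
Proof.
case: mu mu0 z => p q /= q0 [c d]; exists (c - d / q * p), (d / q).
by apply/eqP; rewrite eq_complex /=; apply/andP; split; apply/eqP; field;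
  rewrite gt_eqF.
Qed.

(** This trades the quotient topology for estimates in [R[i]]. From right to left, [f n - L n] has
    the same class as [f n] and is close to [l]. From left to right, [L n] is a lattice point close
    to [f n - l], and discreteness lets one choice serve all tolerances. *)
Lemma torus_proj_cvgP f l :
  (fun n => torus_proj mu (f n)) @ uf_sets V --> torus_proj mu l <->
  exists2 L, (forall n, L n \in lattice mu) &
    starcl V (fun n => f n - l - L n) \in infinitesimal V R[i].
Proof.
split=> [fl|[L LL /infinitesimal_starcl fL]]; last first.
  move=> U; rewrite nbhsE => -[W [oW Wl] WU].
  have : nbhs (l : R[i]^o) (torus_proj mu @^-1` W).
    by apply: open_nbhs_nbhs.
  move=> /nbhs_ballP[e /= e0 eW].
  apply: filterS (fL e e0) => n fne; apply: WU.
  have /eW : ball (l : R[i]^o) e (f n - L n).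
    by rewrite -ball_normE /= distrC addrAC.
  rewrite /=; congr (W _).
  by apply/torus_projP; rewrite addrAC subrr sub0r rpredN.
have [e e0 eP] := lattice_discrete mu0.
have close d : 0 < d -> \forall n \near uf_sets V,
    exists2 w, w \in lattice mu & `|f n - l - w| < d.
  move=> d0; pose W := torus_proj mu @` [set z | `|z - l| < d].
  have oW : open W.
    (* Translation by the lattice vector [z' - z] carries a small ball around [z] into the ball
       around [l]. *)
    rewrite open_torusE openE => z [z' zl' /torus_projP zz].
    rewrite /interior; apply/nbhs_ballP; exists (d - `|z' - l|) => /=.
      by rewrite subr_gt0.
    move=> u; rewrite -ball_normE /= => uz.
    exists (u + (z' - z)) => /=; last first.
      by apply/torus_projP; rewrite addrAC subrr add0r.
    have -> : u + (z' - z) - l = (z' - l) - (z - u).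
      by ring.
    rewrite (le_lt_trans (ler_normB _ _))// addrC.
    by move: uz; rewrite ltrBrDr.
  have Wl : nbhs (torus_proj mu l) W.
    by apply: open_nbhs_nbhs; split => //; exists l; rewrite //= subrr normr0.
  have : \forall n \near uf_sets V, W (torus_proj mu (f n)) := fl _ Wl.
  apply: filterS => n [z zl /torus_projP zf]; exists (f n - z).
    by rewrite -rpredN opprB.
  by have -> : f n - l - (f n - z) = z - l by ring.
(* Two lattice points within [e / 2] of the same point coincide, so [P n] has at most one solution.
   The default value 0 keeps [L n] in the lattice when there is none. *)
pose P n w := w \in lattice mu /\ `|f n - l - w| < e / 2.
pose L n := xget 0 (P n).
have LL n : L n \in lattice mu.
  by rewrite /L; case: xgetP => [w _ []//|_]; rewrite rpred0.
exists L => //; apply/infinitesimal_starcl => d d0.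
have e2 : 0 < e / 2 by rewrite divr_gt0.
(* [R[i]] is only partially ordered; [d] and [e / 2] are comparable because both are positive, hence
   real. *)
have [d' d'0 [d'd d'e]] : exists2 d', 0 < d' & d' <= d /\ d' <= e / 2.
  have [de|/ltW ed] := real_leP (gtr0_real d0) (gtr0_real e2).
    by exists d.
  by exists (e / 2).
apply: filterS (close _ d'0) => n [w wL wd].
have [_ Le] : P n (L n).
  rewrite /L; apply: (@xgetPex _ 0 (P n)); exists w; split=> //.
  exact: lt_le_trans d'e.
suff <- : w = L n by exact: lt_le_trans d'd.
apply/eqP; rewrite -subr_eq0; apply/eqP; apply: eP; first by rewrite rpredB.
have -> : w - L n = (f n - l - L n) - (f n - l - w) by ring.
rewrite (le_lt_trans (ler_normB _ _))// [ltRHS]splitr ltrD//.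
exact: lt_le_trans d'e.
Qed.

Lemma lattice_limit f z : (forall n, f n \in lattice mu) ->
  starcl V (fun n => f n - z) \in infinitesimal V R[i] -> z \in lattice mu.
Proof.
move=> fL /infinitesimal_starcl fz.
have [e e0 eP] := lattice_discrete mu0.
have e2 : 0 < e / 2 by rewrite divr_gt0.
have fze := fz _ e2; have [n nz] := filter_ex fze.
suff /eqP : f n - z = 0 by rewrite subr_eq0 => /eqP <-.
(* Otherwise [|f n - z|] serves as a tolerance: some [f m] is strictly closer to [z], yet
   discreteness forces [f m = f n]. *)
apply/eqP; apply: contraT; rewrite -normr_gt0 => /fz fz0.
have [m [mz]] := filter_ex (filterI fze fz0).
suff -> : f m = f n by rewrite ltxx.
apply/eqP; rewrite -subr_eq0; apply/eqP; apply: eP; first by rewrite rpredB.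
have -> : f m - f n = (f m - z) - (f n - z) by ring.
by rewrite (le_lt_trans (ler_normB _ _))// [ltRHS]splitr ltrD.
Qed.

(** The difference [M - L] of the two lattice sequences converges to [z - l], which is therefore a
    lattice point. *)
Lemma torus_proj_cvg_unique f z l :
  (fun n => torus_proj mu (f n)) @ uf_sets V --> torus_proj mu z ->
  (fun n => torus_proj mu (f n)) @ uf_sets V --> torus_proj mu l ->
  torus_proj mu z = torus_proj mu l.
Proof.
move=> /torus_proj_cvgP[L LL fL] /torus_proj_cvgP[M ML fM]; apply/torus_projP.
apply: (@lattice_limit (fun n => M n - L n)) => [n|]; first by rewrite rpredB.
have := infinitesimalB fL fM; by apply: infinitesimal_ext => n; ring.
Qed.

Lemma torus_proj_cvg_ex f :
  exists l, (fun n => torus_proj mu (f n)) @ uf_sets V --> torus_proj mu l.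
Proof.
have /choice[a /choice[b fE]] :
    forall n, exists a b : R, f n = a%:C + b%:C * mu.
  by move=> n; exact: coordE.
have frac (x : R) : 0 <= x - (Num.floor x)%:~R <= 1.
  have /andP[h1 h2] := floor_itv x.
  by rewrite subr_ge0 h1 lerBlDl ltW//; move: h2; rewrite intrD.
have [x ax] := unit_seq_ulimit V (fun n => frac (a n)).
have [y by_] := unit_seq_ulimit V (fun n => frac (b n)).
exists (x%:C + y%:C * mu); apply/torus_proj_cvgP.
exists (fun n => (Num.floor (a n))%:~R + (Num.floor (b n))%:~R * mu) => [n|].
  by apply/asboolP; do 2!eexists.
have := iffRL (infinitesimal_coord V _ _ mu0) (conj ax by_).
apply: infinitesimal_ext => n.
by rewrite fE !rmorphB /= !rmorph_int; ring.
Qed.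

End Torus.

(** * The standard part on the line: additivity, surjectivity, kernel *)

Section Std.
Variables (R : realType) (V : nonprincipal_ultrafilter).
Variables (mu : R[i]) (theta : R).
Hypothesis mu0 : 0 < complex.Im mu.
Implicit Types (r s : nat -> R) (l : R[i]).

Definition line_seq r : nat -> R[i] := fun n => (r n)%:C * slope mu theta.

Definition line_pt r : bullet V R[i] := bulletcl (starcl V (line_seq r)).

Lemma bullet_lineP x :
  bullet_line V mu theta x <-> exists r, x = line_pt r.
Proof.
split=> [[r _ <-]|[r ->]]; last first.
  by exists (bulletcl (starcl V r)) => //; exact: bullet_scaleE.
exists (repr (repr r)); rewrite /line_pt -bullet_scaleE starcl_repr.
by congr bullet_scale; rewrite /bulletcl reprK.
Qed.

Lemma line_ptD r s : line_pt r + line_pt s = line_pt (fun n => r n + s n).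
Proof.
transitivity (bulletcl (starcl V (line_seq r) + starcl V (line_seq s))).
  by apply/esym; exact: raddfD.
rewrite -starclD; congr (bulletcl (starcl V _)).
by apply/funext => n; rewrite /line_seq rmorphD mulrDl.
Qed.

(** The sequence chosen inside [std] differs from [line_seq r] by an infinitesimal, so it has the
    same limit in the torus; uniqueness of limits then determines [lim]. *)
Lemma std_line_pt r l :
  (fun n => torus_proj mu (line_seq r n)) @ uf_sets V --> torus_proj mu l ->
  std V mu theta (line_pt r) = torus_proj mu l.
Proof.
move=> rl; rewrite /std; set p := xget _ _.
pose F := (fun n => torus_proj mu (line_seq (repr (repr p)) n)) @ uf_sets V.
rewrite -[lim _]/(lim F); have : bullet_scale p (slope mu theta) = line_pt r.
  apply: (@xgetPex _ 0 [set p | bullet_scale p (slope mu theta) = line_pt r]).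
  by exists (bulletcl (starcl V r)); exact: bullet_scaleE.
have -> : p = bulletcl (starcl V (repr (repr p))).
  by rewrite starcl_repr /bulletcl reprK.
rewrite bullet_scaleE; move=> /bulletcl_eq; rewrite -starclB => pr.
have pl : F --> torus_proj mu l.
  have [L LL rL] := iffLR (torus_proj_cvgP V mu0 _ _) rl.
  apply/torus_proj_cvgP => //; exists L => //.
  have := infinitesimalD pr rL; apply: infinitesimal_le => n.
  by rewrite addrA addrA subrK.
have := cvgP _ pl; have [z <-] := torus_proj_surj (lim F).
by move=> pz; apply: torus_proj_cvg_unique pz pl.
Qed.

Lemma std_line_pt_cvg r :
  (fun n => torus_proj mu (line_seq r n)) @ uf_sets V -->
    std V mu theta (line_pt r).
Proof.
have [l rl] := torus_proj_cvg_ex V mu0 (line_seq r).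
by rewrite (std_line_pt rl).
Qed.

Lemma stdD r s : std V mu theta (line_pt r + line_pt s) =
  std V mu theta (line_pt r) + std V mu theta (line_pt s).
Proof.
have [l rl] := torus_proj_cvg_ex V mu0 (line_seq r).
have [z sz] := torus_proj_cvg_ex V mu0 (line_seq s).
rewrite line_ptD (std_line_pt rl) (std_line_pt sz) -torus_projD.
apply: std_line_pt; apply/torus_proj_cvgP => //.
have [L LL rL] := iffLR (torus_proj_cvgP V mu0 _ _) rl.
have [M ML sM] := iffLR (torus_proj_cvgP V mu0 _ _) sz.
exists (fun n => L n + M n) => [n|]; first by rewrite rpredD.
have := infinitesimalD rL sM; apply: infinitesimal_ext => n.
by rewrite /line_seq rmorphD; ring.
Qed.

Lemma std_surj (t : torus mu) : irrational theta ->
  exists r, std V mu theta (line_pt r) = t.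
Proof.
move=> irr; have [z <-] := torus_proj_surj t.
have [a [b zE]] := coordE mu0 z.
(* With [r = a + k], [r * slope - (k + m * mu)] equals [a + (a * theta + k * theta - m) * mu]. It
   tends to [a + b * mu] once [k * theta - m] tends to [b - a * theta]. *)
have /choice[k /choice[m kmP]] : forall n, exists k m : int,
    `|k%:~R * theta - m%:~R - (b - a * theta)| < n.+1%:R^-1.
  by move=> n; apply: (irrational_dense V).
exists (fun n => a + (k n)%:~R); apply: std_line_pt.
apply/torus_proj_cvgP => //.
exists (fun n => (k n)%:~R + (m n)%:~R * mu) => [n|].
  by apply/asboolP; do 2!eexists.
have : starcl V (fun n => (k n)%:~R * theta - (m n)%:~R - (b - a * theta))
    \in infinitesimal V R.
  apply/infinitesimal_starcl => e e0.
  apply: filterS (uf_tail V (Num.bound e^-1)) => n en.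
  apply: (lt_trans (kmP n)); rewrite invf_plt ?posrE//.
  apply: (lt_le_trans (archi_boundP _)); first by rewrite invr_ge0 ltW.
  by rewrite ler_nat leqW.
move=> /infinitesimal_real_complex/(infinitesimalMr mu).
apply: infinitesimal_ext => n.
rewrite zE /line_seq /slope !(rmorphB, rmorphD, rmorphM) /= !rmorph_int.
by ring.
Qed.

(** This removes [perp] in favour of integer sequences: by uniqueness, any [b] with [a * theta - b]
    infinitesimal represents the dual of [a]. *)
Lemma star_lattice_thetaP (x : bullet V R[i]) :
  (@bulletcl V R[i] @` star_lattice_theta V mu theta) x <->
  exists a b : nat -> int,
    starcl V (fun n => (a n)%:~R * theta - (b n)%:~R) \in infinitesimal V R /\
    x = bulletcl (starcl V (fun n => mu * (b n)%:~R + (a n)%:~R)).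
Proof.
have nearE (a b : nat -> int) : starZ_near theta (starcl V a) (starcl V b) <->
    starcl V (fun n => (a n)%:~R * theta - (b n)%:~R) \in infinitesimal V R.
  by rewrite /starZ_near !star_map_starcl /star_cst -starclM -starclB.
have latE (a b : nat -> int) : star_cst V mu * star_map intr (starcl V b) +
    star_map intr (starcl V a) =
    starcl V (fun n => mu * (b n)%:~R + (a n)%:~R).
  by rewrite !star_map_starcl /star_cst -starclM -starclD.
split=> [[_ [p /= [q pq] <-] <-]|[a [b [ab ->]]]].
  have perpP : starZ_near theta p (perp theta p).
    by apply: (@xgetPex _ 0 [set m | starZ_near theta p m]); exists q.
  exists (repr p), (repr (perp theta p)).
  by rewrite -nearE -latE !starcl_repr.
exists (starcl V (fun n => mu * (b n)%:~R + (a n)%:~R)) => //.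
have ab' := iffRL (nearE a b) ab.
exists (starcl V a); first by exists (starcl V b).
rewrite (_ : perp theta _ = starcl V b) ?latE//.
apply: (starZ_near_unique _ ab').
by apply: (@xgetPex _ 0 (starZ_near theta (starcl V a))); exists (starcl V b).
Qed.

Lemma std_kernel :
  bullet_line V mu theta `&` std V mu theta @^-1` [set 0] =
    @bulletcl V R[i] @` star_lattice_theta V mu theta.
Proof.
have proj0 : torus_proj mu 0 = 0 by exact: raddf0.
apply/seteqP; split=> x.
  move=> [/bullet_lineP[r ->] /= r0]; apply/star_lattice_thetaP.
  have := @std_line_pt_cvg r; rewrite r0 -proj0.
  move=> /(iffLR (torus_proj_cvgP V mu0 _ _))[L LL rL].
  have /choice[a /choice[b LE]] :
      forall n, exists a b : int, L n = a%:~R + b%:~R * mu.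
    by move=> n; apply/asboolP; exact: LL.
  exists a, b.
  have [ra rb] : starcl V (fun n => r n - (a n)%:~R) \in infinitesimal V R /\
      starcl V (fun n => r n * theta - (b n)%:~R) \in infinitesimal V R.
    apply: (iffLR (infinitesimal_coord V _ _ mu0)).
    move: rL; apply: infinitesimal_ext => n.
    rewrite LE /line_seq /slope !(rmorphB, rmorphM) /= !rmorph_int.
    by ring.
  (* Here [a * theta - b = (r * theta - b) - (r - a) * theta]. *)
  split.
    have := infinitesimalB rb (infinitesimalMr theta ra).
    apply: infinitesimal_ext => n.
    by ring.
  apply/bulletcl_eq; rewrite -starclB; move: rL; apply: infinitesimal_le => n.
  by rewrite LE subr0 [mu * _]mulrC addrC [_ * mu + _]addrC addrC.
move=> /star_lattice_thetaP[a [b [ab ->]]].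
(* Conversely, [a * slope - (a + b * mu) = (a * theta - b) * mu] is infinitesimal. This puts the
   point on the line with parameter [a], and shows below that its standard part is 0. *)
have -> : bulletcl (starcl V (fun n => mu * (b n)%:~R + (a n)%:~R)) =
    line_pt (fun n => (a n)%:~R).
  apply/esym/bulletcl_eq; rewrite -starclB.
  have := infinitesimalMr mu (iffRL (infinitesimal_real_complex V _) ab).
  apply: infinitesimal_ext => n.
  rewrite /line_seq /slope !(rmorphB, rmorphM) /= !rmorph_int.
  by ring.
split; first by apply/bullet_lineP; eexists.
rewrite /= -proj0; apply: std_line_pt; apply/torus_proj_cvgP => //.
exists (fun n => (a n)%:~R + (b n)%:~R * mu) => [n|].
  by apply/asboolP; do 2!eexists.
have := infinitesimalMr mu (iffRL (infinitesimal_real_complex V _) ab).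
apply: infinitesimal_ext => n.
rewrite /line_seq /slope !(rmorphB, rmorphM) /= !rmorph_int.
by ring.
Qed.

End Std.

Theorem theorem2 (R : realType) (V : nonprincipal_ultrafilter)
    (mu : R[i]) (theta : R)
    (mu_upper : 0 < complex.Im mu) (theta_irrational : irrational theta) :
  [/\ (* well defined, whatever the representative sequence *)
      forall r : nat -> R,
        (fun n => torus_proj mu ((r n)%:C * slope mu theta)) @ uf_sets V -->
          std V mu theta (bullet_scale (bulletcl (starcl V r)) (slope mu theta)),
      (* homomorphism *)
      {in bullet_line V mu theta &,
        {morph std V mu theta : x y / x + y}},
      (* surjective *)
      std V mu theta @` bullet_line V mu theta = [set: torus mu]
    & (* kernel *)
      bullet_line V mu theta `&` std V mu theta @^-1` [set 0] =
        @bulletcl V R[i] @` star_lattice_theta V mu theta ].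

Proof.
split.
- by move=> r; rewrite bullet_scaleE; exact: std_line_pt_cvg.
- move=> _ _ /set_mem/bullet_lineP[r ->] /set_mem/bullet_lineP[s ->].
  exact: stdD.
- apply/seteqP; split=> // t _.
  have [r <-] := std_surj V mu_upper t theta_irrational.
  by exists (line_pt V mu theta r) => //; apply/bullet_lineP; exists r.
- exact: std_kernel.
Qed.
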